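(* There exists a simple $4$-dimensional convex polytope $P$ that does not weakly satisfy Perles' conjecture. That is, the graph $G(P)$ has an induced, $3$-connected, $3$-regular, non-separating subgraph that is not the graph of a facet of $P$.
   Context: For a convex polytope $P$, $G(P)$ denotes its graph, formed by the vertices and edges of $P$. A $d$-polytope is simple if every vertex lies in exactly $d$ facets. A subgraph $H$ of $G(P)$ is non-separating if deleting the vertices of $H$ from $G(P)$ leaves a connected graph. $H$ is the graph of a facet if it is the subgraph formed by the vertices and edges of some facet of $P$. A simple $d$-polytope $P$ satisfies Perles' conjecture if every induced, connected, $(d-1)$-regular, non-separating subgraph of $G(P)$ is the graph of a facet of $P$. It weakly satisfies Perles' conjecture if every induced, $(d-1)$-connected, $(d-1)$-regular, non-separating subgraph of $G(P)$ is the graph of a facet of $P$. *)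

(* Defs.v *)
From Stdlib Require Export Relation_Operators.
From mathcomp Require Export all_boot all_order all_algebra.
From mathcomp Require Export boolp classical_sets functions cardinality reals.

Set Implicit Arguments.
Unset Strict Implicit.
Unset Printing Implicit Defensive.

Import Order.TTheory GRing.Theory Num.Theory.

Local Open Scope classical_set_scope.
Local Open Scope card_scope.
Local Open Scope ring_scope.

(** Simple graphs on a (possibly infinite) carrier type; the vertices form a
    subset of the carrier, so that subgraphs live on the same type. *)

Record graph (T : Type) := Graph {
  vert : set T;
  adj : T -> T -> Prop;
  adj_sym : forall u v, adj u v -> adj v u;
  adj_irr : forall u, ~ adj u u;
  adj_vert : forall u v, adj u v -> vert u }.

Section Graphs.
Variable T : Type.
Implicit Types (G H : graph T) (S : set T).

Definition same_graph G H : Prop :=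
  vert G = vert H /\ (forall u v, adj G u v <-> adj H u v).

Definition induced_subgraph G H : Prop :=
  vert H `<=` vert G /\
  (forall u v, adj H u v <-> [/\ vert H u, vert H v & adj G u v]).

Definition delete_vertices G S : graph T.
Proof.
refine {| vert := vert G `\` S;
          adj := fun u v => [/\ adj G u v, ~ S u & ~ S v] |}.
- by move=> u v [uv ? ?]; split=> //; apply: adj_sym uv.
- by move=> u [uu _ _]; apply: adj_irr uu.
- by move=> u v [uv ? _]; split=> //; apply: adj_vert uv.
Defined.

(** The empty graph is not connected. *)
Definition connected_graph G : Prop :=
  vert G !=set0 /\
  (forall u v, vert G u -> vert G v -> clos_refl_trans T (adj G) u v).

Definition regular_graph (k : nat) G : Prop :=
  forall u, vert G u -> [set v | adj G u v] #= `I_k.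

(** [`I_k.+1 #<= A] says that [A] has more than [k] elements, and
    [~ (`I_k #<= S)] that [S] has fewer than [k]. *)
Definition k_connected (k : nat) G : Prop :=
  `I_k.+1 #<= vert G /\
  (forall S, S `<=` vert G -> ~ (`I_k #<= S) ->
     connected_graph (delete_vertices G S)).

Definition non_separating G H : Prop :=
  connected_graph (delete_vertices G (vert H)).

End Graphs.

Section Polytopes.
Variables (R : realType) (n : nat).
Local Notation V := 'rV[R]_n.
Implicit Types (A P F : set V) (u v x : V).

Definition affine_hull A : set V :=
  [set x | exists (m : nat) (p : 'I_m -> V) (c : 'I_m -> R),
     [/\ forall i, A (p i), \sum_i c i = 1 & x = \sum_i c i *: p i]].

Definition convex_hull A : set V :=
  [set x | exists (m : nat) (p : 'I_m -> V) (c : 'I_m -> R),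
     [/\ forall i, A (p i), forall i, 0 <= c i, \sum_i c i = 1
       & x = \sum_i c i *: p i]].

(** The affine hull of [A] is a translate of a [k]-dimensional linear
    subspace; in particular the empty set has no dimension. *)
Definition has_dim A (k : nat) : Prop :=
  exists (x : V) (U : {vspace V}),
    \dim U = k /\ affine_hull A = [set x + u | u in [set` U]].

Definition polytope P : Prop :=
  exists s : seq V, P = convex_hull [set` s].

Definition dot (c x : V) : R := \sum_i c 0 i * x 0 i.

(** Faces are cut out by valid inequalities; [c = 0] gives the improper faces
    [P] and [set0]. *)
Definition face P F : Prop :=
  exists (c : V) (b : R),
    (forall x, P x -> dot c x <= b) /\ F = [set x | P x /\ dot c x = b].

Definition vertex P v : Prop := face P [set v].

Definition facet P F : Prop :=
  face P F /\ exists k : nat, has_dim F k /\ has_dim P k.+1.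

Definition edge_between P u v : Prop :=
  u <> v /\
  exists F, [/\ face P F, has_dim F 1, vertex P u /\ F u & vertex P v /\ F v].

Definition polytope_graph P : graph V.
Proof.
refine {| vert := vertex P; adj := edge_between P |}.
- move=> u v [neq_uv [F [? ? ? ?]]]; split; first by move=> /esym.
  by exists F.
- by move=> u [].
- by move=> u v [_ [F [_ _ [? _] _]]].
Defined.

Definition simple_polytope (d : nat) P : Prop :=
  [/\ polytope P, has_dim P d
    & forall v, vertex P v -> [set F | facet P F /\ F v] #= `I_d].

(** A facet [F] is itself a polytope, and its graph consists of the vertices
    and edges of [F]. *)
Definition graph_of_facet P (H : graph V) : Prop :=
  exists F, facet P F /\ same_graph H (polytope_graph F).

Definition weakly_satisfies_Perles (d : nat) P : Prop :=
  forall H : graph V,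
    induced_subgraph (polytope_graph P) H ->
    k_connected d.-1 H ->
    regular_graph d.-1 H ->
    non_separating (polytope_graph P) H ->
    graph_of_facet P H.

End Polytopes.

(* Main.v *)
Require Import Defs.
From mathcomp Require Import lra.

Set Implicit Arguments.
Unset Strict Implicit.
Unset Printing Implicit Defensive.

Import Order.TTheory GRing.Theory Num.Theory.
Local Open Scope classical_set_scope.
Local Open Scope card_scope.
Local Open Scope ring_scope.

(** In the simplicial 3-sphere dual to a simple 4-polytope, the vertices of the
    polytope become tetrahedra, its edges become pairs of tetrahedra with a
    common triangle, and its facets become the vertex stars.  An induced
    3-regular subgraph is then a set T of tetrahedra each of which has exactly
    one triangle on the boundary of T.  Vertex stars have this property, and
    Perles' conjecture says that nothing else does, once T and its complement
    are connected.  A counterexample is therefore a set T of this kind that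
    contains no full vertex star.

    Such a T exists already in a sphere with 12 vertices and 39 tetrahedra,
    and the sphere is the boundary of the convex hull of 12 lattice points with
    coordinates of absolute value at most 3.  The polytope [example] is the
    polar of that hull, cut out by the inequalities [dot (normal f) x <= 1]; it
    is given here as the convex hull of its 39 vertices [point v], and T
    consists of the first 26 of them.  Every facet has a vertex outside T
    ([facet_leaves_obstruction]), so T is not the vertex set of a facet.

    What remains is to read off the graph and the facets of [example] from the
    incidences between inequalities and vertices.  This is local: if a vertex
    [v] has neighbours [w j] such that the [j]-th of its tight inequalities is
    strict at [w j] and tight at the other neighbours ([corner]), then the edge
    vectors [w j - v] form a basis, and the whole set lies in the cone that they
    span at [v].  A face through [v] is determined by the edge vectors that it
    contains ([face_of_corner], [has_dim_corner_face]); so the edges at [v] lead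
    to the [w j] ([edge_corner]), and the facets at [v] are those of its four
    tight inequalities ([facet_corner]).  All hypotheses of these lemmas,
    and the regularity and connectivity of the graphs involved, are then
    finitely many statements about integers, decided by computation. *)

(** * Cardinality, scalar products and dimension *)

Lemma card_set_seq (T : eqType) (s : seq T) :
  uniq s -> [set` s] #= `I_(size s).
Proof.
elim: s => [|x s IH] /=.
  by rewrite II0 (_ : [set` [::]] = set0) // -subset0.
move=> /andP[xs us]; apply/eq_cardSP; exists x; first exact: mem_head.
suff -> : [set` x :: s] `\ x = [set` s] by exact: IH.
apply/seteqP; split=> y /=; first by rewrite inE => -[/predU1P[]].
by move=> ys; rewrite inE ys orbT; split=> // yx; rewrite -yx ys in xs.
Qed.

Section Dot.
Variables (R : realType) (n : nat).
Implicit Types (a x y : 'rV[R]_n).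

Lemma dotDr a x y : dot a (x + y) = dot a x + dot a y.
Proof. by rewrite -big_split; apply: eq_bigr => i _; rewrite mxE mulrDr. Qed.

Lemma dotZr a k x : dot a (k *: x) = k * dot a x.
Proof. by rewrite big_distrr; apply: eq_bigr => i _; rewrite mxE mulrCA. Qed.

Lemma dotBr a x y : dot a (x - y) = dot a x - dot a y.
Proof. by rewrite dotDr -scaleN1r dotZr mulN1r. Qed.

Lemma dot_sumr a (I : finType) (r : pred I) (f : I -> 'rV[R]_n) :
  dot a (\sum_(i | r i) f i) = \sum_(i | r i) dot a (f i).
Proof.
rewrite /dot exchange_big; apply: eq_bigr => j _.
by rewrite summxE big_distrr.
Qed.

Lemma dot_suml (I : finType) (r : pred I) (f : I -> 'rV[R]_n) x :
  dot (\sum_(i | r i) f i) x = \sum_(i | r i) dot (f i) x.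
Proof.
rewrite /dot exchange_big; apply: eq_bigr => j _.
by rewrite summxE big_distrl.
Qed.

End Dot.

Section Dimension.
Variables (R : realType) (n : nat).
Implicit Types (A : set 'rV[R]_n).

(** Two translates of linear subspaces coincide only if the subspaces do. *)
Lemma has_dim_inj A k k' : has_dim A k -> has_dim A k' -> k = k'.
Proof.
move=> [x [U [<- eU]]] [y [W [<- eW]]].
have hU z : z \in U -> exists2 u, u \in W & x + z = y + u.
  move=> zU; have : affine_hull A (x + z) by rewrite eU; exists z.
  by rewrite eW => -[u uW <-]; exists u.
have hW z : z \in W -> exists2 u, u \in U & y + z = x + u.
  move=> zU; have : affine_hull A (y + z) by rewrite eW; exists z.
  by rewrite eU => -[u uW <-]; exists u.
congr (\dim _); apply/vspaceP => z.
have [u0 u0W e0] := hU _ (mem0v _); have [u1 u1U e1] := hW _ (mem0v _).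
rewrite !addr0 in e0 e1.
apply/idP/idP => [/hU|/hW] [u uin e].
  suff -> : z = u - u0 by rewrite memvB.
  by apply: (addrI x); rewrite e e0 [u - _]addrC addrA addrK.
suff -> : z = u - u1 by rewrite memvB.
by apply: (addrI y); rewrite e e1 [u - _]addrC addrA addrK.
Qed.

Lemma has_dim_nonempty A k : has_dim A k -> A !=set0.
Proof.
move=> [x [U [_ eU]]].
have : affine_hull A x by rewrite eU; exists 0; [exact: mem0v|rewrite addr0].
move=> [[|m] [p [c [Ap c1 _]]]]; last by exists (p ord0).
by move: c1; rewrite big_ord0 => /esym/eqP; rewrite oner_eq0.
Qed.

End Dimension.

(** * Faces through a simple vertex *)

(** A simple vertex of a full-dimensional set, with its neighbours [w j]; the
    inequality [a j] is the one that the edge towards [w j] leaves. *)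
Record corner (R : realType) (n : nat) (P : set 'rV[R]_n) (v : 'rV[R]_n)
    (w a : 'I_n -> 'rV[R]_n) (b : 'I_n -> R) : Prop := Corner {
  corner_in : P v;
  corner_nbr_in : forall j, P (w j);
  corner_valid : forall j x, P x -> dot (a j) x <= b j;
  corner_tight : forall j, dot (a j) v = b j;
  corner_off : forall j k, j != k -> dot (a j) (w k) = b j;
  corner_lt : forall j, dot (a j) (w j) < b j }.

(** A valid inequality that is tight at [x] is tight at both ends of a segment
    of [P] around [x], whereas a vertex admits one that is tight only at [x]. *)
Lemma vertex_inside (R : realType) (n : nat) (P : set 'rV[R]_n) x y z s :
  vertex P x -> P y -> P z -> x = y + s *: (z - y) -> 0 < s -> s < 1 -> y = x.
Proof.
move=> [c [d [valid ex]]] Py Pz xyz s0 s1.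
have cx : dot c x = d by have : [set x] x by []; rewrite ex => -[].
suff : [set x] y by []; rewrite ex; split=> //; apply/le_anti.
rewrite valid //= -(@ler_pM2l _ (1 - s)) ?subr_gt0 //.
have : 0 <= s * (d - dot c z) by apply: mulr_ge0; [exact: ltW | rewrite subr_ge0 valid].
by move: cx; rewrite xyz dotDr dotZr dotBr; lra.
Qed.

Section Corner.
Variables (R : realType) (n : nat) (P : set 'rV[R]_n) (v : 'rV[R]_n).
Variables (w a : 'I_n -> 'rV[R]_n) (b : 'I_n -> R).
Hypothesis cP : corner P v w a b.
Implicit Types (x : 'rV[R]_n) (F : set 'rV[R]_n) (J : {set 'I_n}).

Let e j := w j - v.
(* The coordinate of [x - v] along [e j]; it is nonnegative on [P]. *)
Let t j x := (b j - dot (a j) x) / (b j - dot (a j) (w j)).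

Definition corner_face J : set 'rV[R]_n :=
  [set x | P x /\ forall j, j \notin J -> dot (a j) x = b j].

Definition corner_space J : {vspace 'rV[R]_n} := (\sum_(j in J) <[w j - v]>)%VS.

Let slack_gt0 j : 0 < b j - dot (a j) (w j).
Proof. by rewrite subr_gt0 (corner_lt cP). Qed.

Let dot_e j k : j != k -> dot (a j) (e k) = 0.
Proof. by move=> jk; rewrite dotBr (corner_off cP jk) (corner_tight cP) subrr. Qed.

Let dot_ee j : dot (a j) (e j) = - (b j - dot (a j) (w j)).
Proof. by rewrite dotBr (corner_tight cP) opprB. Qed.

Let dot_comb (c : 'I_n -> R) j (r : pred 'I_n) :
  r j -> dot (a j) (\sum_(k | r k) c k *: e k) = - c j * (b j - dot (a j) (w j)).
Proof.
move=> rj; rewrite dot_sumr (bigD1 j) //= big1 ?addr0.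
  by rewrite dotZr dot_ee mulrN mulNr.
by move=> k /andP[_ kj]; rewrite dotZr dot_e ?mulr0 // eq_sym.
Qed.

(** The functionals [a j] are, up to positive factors, minus the dual basis. *)
Lemma corner_free : free [seq w j - v | j <- enum 'I_n].
Proof.
have -> : [seq w j - v | j <- enum 'I_n] = [tuple e j | j < n] by [].
apply/freeP => c; under eq_bigr do rewrite -tnth_nth tnth_mktuple.
move=> c0 j; have := @dot_comb c j xpredT isT; rewrite c0.
rewrite -[0]subr0 dotBr subrr => /esym/eqP.
by rewrite mulf_eq0 oppr_eq0 [X in _ || X]gt_eqF ?orbF // => /eqP.
Qed.

Lemma corner_coord x : x = v + \sum_j t j x *: (w j - v).
Proof.
have bas : basis_of fullv [tuple e j | j < n].
  by rewrite basisEfree corner_free subvf size_tuple dimvf dim_matrix mul1r leqnn.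
have xin : x - v \in <<[tuple e j | j < n]>>%VS by rewrite (span_basis bas) memvf.
have ex : x - v = \sum_j coord [tuple e j | j < n] j (x - v) *: e j.
  rewrite {1}(coord_span xin); apply: eq_bigr => j _.
  by rewrite -tnth_nth tnth_mktuple.
rewrite -[LHS](subrK v) addrC; congr (_ + _); rewrite {1}ex.
apply: eq_bigr => j _; congr (_ *: _).
rewrite /t; have -> : b j - dot (a j) x = - dot (a j) (x - v).
  by rewrite dotBr opprB (corner_tight cP).
by rewrite [X in dot _ X]ex dot_comb // !mulNr opprK mulfK // gt_eqF.
Qed.

Let t_ge0 j x : P x -> 0 <= t j x.
Proof.
by move=> Px; rewrite divr_ge0 ?(ltW (slack_gt0 j)) // subr_ge0 (corner_valid cP).
Qed.

Lemma dim_corner_space J : \dim (corner_space J) = #|J|.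
Proof.
have -> : corner_space J = <<[seq w j - v | j <- enum J]>>%VS.
  by rewrite span_def big_map big_enum.
have/eqP -> : free [seq w j - v | j <- enum J].
  have : perm_eq (enum 'I_n) (enum J ++ enum (~: J)).
    apply: uniq_perm; rewrite ?enum_uniq ?cat_uniq ?enum_uniq //= ?andbT.
      by apply/hasPn => x; rewrite !mem_enum inE.
    by move=> x; rewrite mem_cat !mem_enum !inE orbN.
  move/(perm_map (fun j => w j - v))/perm_free.
  by rewrite corner_free map_cat => /esym/catl_free.
by rewrite size_map -cardE.
Qed.

(** A point of the face has zero coordinates outside [J], and the face contains
    the affinely independent points [v] and [w j] for [j] in [J]. *)
Lemma has_dim_corner_face J : has_dim (corner_face J) #|J|.
Proof.
exists v, (corner_space J); split; first exact: dim_corner_space.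
apply/seteqP; split=> x /=.
  move=> [m [p [c [Fp c1 ->]]]].
  exists (\sum_i c i *: (p i - v)); last first.
    under [in LHS]eq_bigr do rewrite scalerBr.
    by rewrite sumrB -scaler_suml c1 scale1r addrC subrK.
  apply: memv_suml => i _; apply: memvZ.
  have [Pp eqb] := Fp i; rewrite {1}(corner_coord (p i)) addrC addKr.
  rewrite [X in X \in _](bigID (mem J)) /= [X in _ + X]big1 ?addr0.
    apply: memv_sumr => j jJ; apply/memvZ/memv_line.
  by move=> j jJ; rewrite /t eqb // subrr mul0r scale0r.
move=> [u /memv_sumP [f fJ ->] <-].
have {fJ} fJ j : exists c, j \in J -> f j = c *: (w j - v).
  case jJ: (j \in J); last by exists 0.
  by have /vlineP [c ec] := fJ j jJ; exists c.
have [c ec] := choice fJ.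
(* The vector [v + \sum_(j in J) c j *: (w j - v)] as an affine combination:
   index [ord0] carries [v], and so does, with weight 0, each [j] outside [J]. *)
pose c' i := if unlift ord0 i is Some j then (if j \in J then c j else 0)
  else 1 - \sum_(j in J) c j.
pose p' i := if unlift ord0 i is Some j then (if j \in J then w j else v)
  else v.
exists n.+1, p', c'; split.
- move=> i; rewrite /p'; case: (unlift ord0 i) => [j|] /=; last first.
    by split; [exact: (corner_in cP)|move=> k _; rewrite (corner_tight cP)].
  case: ifP => jJ; split.
  + exact: (corner_nbr_in cP).
  + by move=> k kJ; rewrite (corner_off cP) //; apply: contraNneq kJ => ->.
  + exact: (corner_in cP).
  + by move=> k _; rewrite (corner_tight cP).
- rewrite big_ord_recl /c' unlift_none; under [X in _ + X]eq_bigr do rewrite liftK.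
  by rewrite -big_mkcond subrK.
- rewrite big_ord_recl /c' /p' unlift_none; under [X in _ = _ + X]eq_bigr do rewrite liftK.
  rewrite scalerBl scale1r -addrA; congr (_ + _).
  rewrite scaler_suml -sumrN [X in _ = _ + X](_ : _ = \sum_(j in J) c j *: w j).
    rewrite -big_split /=; apply: eq_bigr => j jJ.
    by rewrite (ec j jJ) scalerBr addrC.
  rewrite [RHS]big_mkcond; apply: eq_bigr => j _.
  by case: ifP; rewrite ?scale0r.
Qed.

(** If [dot c x <= d] defines the face, then [d - dot c x] is the sum of the
    products of the coordinates of [x] with the numbers [- dot c (w j - v)], all
    nonnegative; it vanishes exactly when the coordinates with nonzero factor
    do.  So [J] consists of the [j] for which [w j] lies in the face. *)
Lemma face_of_corner F : face P F -> F v -> exists J, F = corner_face J.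
Proof.
move=> [c [d [valid eF]]]; rewrite {1}eF /= => -[Pv cv].
pose J := [set j | dot c (w j) == d]%SET; exists J.
have ce j : dot c (w j - v) <= 0.
  by rewrite dotBr cv subr_le0 valid //; apply: (corner_nbr_in cP).
have ceJ j : (j \in J) = (dot c (w j - v) == 0) by rewrite inE dotBr cv subr_eq0.
have dotc x : dot c x = d + \sum_j t j x * dot c (w j - v).
  rewrite {1}(corner_coord x) dotDr cv dot_sumr; congr (_ + _).
  by apply: eq_bigr => j _; rewrite dotZr.
rewrite eF; apply/seteqP; split=> x /= [Px h]; split=> //.
  move=> j jJ; move: h; rewrite dotc -[RHS]addr0 => /addrI/eqP.
  rewrite -oppr_eq0 -sumrN psumr_eq0; last first.
    by move=> k _; rewrite oppr_ge0 mulr_ge0_le0 // t_ge0.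
  move=> /allP /(_ j (mem_index_enum _)) /=.
  rewrite oppr_eq0 mulf_eq0 -ceJ (negPf jJ) orbF /t mulf_eq0 invr_eq0.
  by rewrite [X in _ || X]gt_eqF ?slack_gt0 // orbF subr_eq0 => /eqP.
rewrite dotc big1 ?addr0 // => j _.
have [|jJ] := boolP (j \in J); first by rewrite ceJ => /eqP ->; rewrite mulr0.
by rewrite /t h // subrr !mul0r.
Qed.

(** The sum of the inequalities outside [J] is tight only where all of them
    are. *)
Lemma face_corner_face J : face P (corner_face J).
Proof.
exists (\sum_(j in ~: J) a j), (\sum_(j in ~: J) b j); split=> [x Px|].
  by rewrite dot_suml ler_sum // => j _; apply: (corner_valid cP _ Px).
apply/seteqP; split=> x /= [Px h]; split=> //.
  by rewrite dot_suml; apply: eq_bigr => j; rewrite inE => /h.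
move=> j jJ; move/esym/eqP: h; rewrite dot_suml -subr_eq0 -sumrB psumr_eq0.
  by move=> /allP /(_ j (mem_index_enum _)); rewrite inE jJ subr_eq0 => /eqP ->.
by move=> k _; rewrite subr_ge0 (corner_valid cP).
Qed.

Lemma corner_face_v J : corner_face J v.
Proof. by split=> [|j _]; [exact: (corner_in cP) | exact: (corner_tight cP)]. Qed.

Lemma corner_face_w J j : corner_face J (w j) <-> j \in J.
Proof.
split=> [[_ h]|jJ].
  by apply: contraPT (corner_lt cP j) => /h ->; rewrite ltxx.
split=> [|k kJ]; first exact: (corner_nbr_in cP).
by apply: (corner_off cP); apply: contraNneq kJ => ->.
Qed.

Lemma corner_face0 : corner_face finset.set0 = [set v].
Proof.
apply/seteqP; split=> [x [Px h]|_ ->]; last exact: corner_face_v.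
rewrite /= (corner_coord x) big1 ?addr0 // => j _.
by rewrite /t h ?inE // subrr mul0r scale0r.
Qed.

Lemma vertex_corner : vertex P v.
Proof. by rewrite /vertex -corner_face0; apply: face_corner_face. Qed.

Lemma has_dim_corner : has_dim P n.
Proof.
have := has_dim_corner_face finset.setT; rewrite cardsT card_ord.
suff -> : corner_face finset.setT = P by [].
by apply/seteqP; split=> [x []|x Px] //; split=> // j; rewrite inE.
Qed.

Lemma facet_corner F :
  (facet P F /\ F v) <-> exists j, F = [set x | P x /\ dot (a j) x = b j].
Proof.
have eqF j : corner_face (~: [set j]%SET) = [set x | P x /\ dot (a j) x = b j].
  apply/seteqP; split=> x /= [Px h]; split=> //; first by apply: h; rewrite !inE eqxx.
  by move=> k; rewrite !inE negbK => /eqP ->.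
split=> [[[fF [k [dF dP]]] Fv]|[j ->]].
  have [J eF] := face_of_corner fF Fv.
  have/eqP := has_dim_inj dP has_dim_corner.
  rewrite eF in dF; rewrite (has_dim_inj dF (has_dim_corner_face J)).
  rewrite -[n in _ == n]card_ord -(cardsC J) -addn1 eqn_add2l eq_sym.
  move=> /cards1P [j ej]; exists j.
  by rewrite eF -(finset.setCK J) ej eqF.
rewrite -eqF; split; last exact: corner_face_v; split; first exact: face_corner_face.
exists #|~: [set j]%SET|; split; first exact: has_dim_corner_face.
suff -> : #|~: [set j]%SET|.+1 = n by exact: has_dim_corner.
by rewrite -[RHS]card_ord -(cardsC [set j]%SET) cards1.
Qed.

Lemma card_facets_corner : [set F | facet P F /\ F v] #= `I_n.
Proof.
pose f j := [set x | P x /\ dot (a j) x = b j].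
have -> : [set F | facet P F /\ F v] = f @` [set: 'I_n].
  apply/seteqP; split=> F /=.
    by move=> /facet_corner [j ->]; exists j.
  by move=> [j _ <-]; apply/facet_corner; exists j.
apply: card_eq_trans (inj_card_eq _) _.
  move=> j k _ _ ejk; apply/eqP/negPn/negP => jk.
  have : f j (w k) by split; [exact: (corner_nbr_in cP)|exact: (corner_off cP jk)].
  by rewrite ejk => -[_ h]; have := corner_lt cP k; rewrite h ltxx.
have -> : [set: 'I_n] = [set` enum 'I_n].
  by apply/seteqP; split=> j // _; rewrite /= mem_enum.
by have := card_set_seq (enum_uniq 'I_n); rewrite size_enum_ord.
Qed.

(** On the ray from [v] through [w j], two vertices of [P] other than [v]
    coincide, since the nearer one would lie inside a segment of [P]. *)
Lemma edge_corner u : (forall j, vertex P (w j)) ->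
  edge_between P v u <-> exists j, u = w j.
Proof.
move=> vw; split=> [[vu [F [fF dF [_ Fv] [vxu Fu]]]]|[j ->]]; last first.
  have nvw : v <> w j.
    by move=> vw0; have := corner_lt cP j; rewrite -vw0 (corner_tight cP) ltxx.
  split=> //; exists (corner_face [set j]%SET); split.
  - exact: face_corner_face.
  - by have := has_dim_corner_face [set j]%SET; rewrite cards1.
  - by split; [exact: vertex_corner | exact: corner_face_v].
  - by split; [exact: vw | apply/corner_face_w; rewrite inE].
have [J eF] := face_of_corner fF Fv; rewrite eF in dF Fu.
have /esym/eqP/cards1P [j eJ] := has_dim_inj dF (has_dim_corner_face J).
exists j; have eu : u = v + t j u *: (w j - v).
  rewrite {1}(corner_coord u) (bigD1 j) //= big1 ?addr0 // => k kj.
  by case: Fu => _ /(_ k); rewrite eJ inE => /(_ kj) h; rewrite /t h subrr mul0r scale0r.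
have t0 : t j u != 0.
  by apply/eqP => t0; apply: vu; rewrite eu t0 scale0r addr0.
have tgt0 : 0 < t j u by rewrite lt0r t0 t_ge0 //; case: Fu.
have [t1|t1|t1] := ltgtP (t j u) 1.
- by case: vu; apply: (vertex_inside vxu (corner_in cP) (corner_nbr_in cP j) eu tgt0 t1).
- have ew : w j = v + (t j u)^-1 *: (u - v).
    have -> : u - v = t j u *: (w j - v) by rewrite {1}eu addrC addKr.
    by rewrite scalerA mulVf // scale1r addrC subrK.
  have it1 : 0 < (t j u)^-1 < 1 by rewrite invr_gt0 tgt0 invf_lt1.
  case/andP: it1 => it0 it1.
  have vwj := vertex_inside (vw j) (corner_in cP) (proj1 Fu) ew it0 it1.
  by have := corner_lt cP j; rewrite -vwj (corner_tight cP) ltxx.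
- by rewrite eu t1 scale1r addrC subrK.
Qed.

End Corner.

(** * Convex hulls of finite sets *)

Section Hull.
Variables (R : realType) (n : nat).
Implicit Types (s : seq 'rV[R]_n) (c x v : 'rV[R]_n).

Lemma subset_convex_hull s x : x \in s -> convex_hull [set` s] x.
Proof.
move=> xs; exists 1%N, (fun=> x), (fun=> 1); split=> //.
- by rewrite big_ord1.
- by rewrite big_ord1 scale1r.
Qed.

Lemma convex_hull_le s c d x :
  (forall y, y \in s -> dot c y <= d) -> convex_hull [set` s] x -> dot c x <= d.
Proof.
move=> le_d [m [p [k [sp k0 k1 ->]]]]; rewrite dot_sumr -[d]mul1r -k1 mulr_suml.
by apply: ler_sum => i _; rewrite dotZr; apply: ler_wpM2l => //; apply/le_d/sp.
Qed.

(** If a convex combination attains the maximum of a linear functional, so does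
    every generator that occurs in it with positive weight. *)
Lemma face_meets_generators s F x :
  face (convex_hull [set` s]) F -> F x -> exists2 y, y \in s & F y.
Proof.
move=> [c [d [valid ->]]] [[m [p [k [sp k0 k1 ex]]]] cx].
have [i ki] : exists i, k i != 0.
  apply/not_existsP => kn; move: k1; rewrite big1 => [/esym/eqP|i _].
    by rewrite oner_eq0.
  by apply/eqP/negPn/negP; apply: kn.
exists (p i); first exact: sp.
split; first exact/subset_convex_hull/sp.
have ge0 j : 0 <= k j * (d - dot c (p j)).
  by rewrite mulr_ge0 // subr_ge0 valid //; apply/subset_convex_hull/sp.
have : \sum_j k j * (d - dot c (p j)) = 0.
  under eq_bigr do rewrite mulrBr -dotZr.
  by rewrite sumrB -mulr_suml k1 mul1r -dot_sumr -ex cx subrr.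
move=> /eqP; rewrite psumr_eq0 // => /allP /(_ i (mem_index_enum _)).
by rewrite mulf_eq0 (negPf ki) subr_eq0 => /eqP.
Qed.

Lemma vertex_subset (P F : set 'rV[R]_n) v :
  F `<=` P -> F v -> vertex P v -> vertex F v.
Proof.
move=> FP Fv [c [d [valid ev]]]; exists c, d; split=> [x /FP/valid //|].
have : [set v] v by []; rewrite {1}ev => -[_ cv].
apply/seteqP; split=> x /=; first by move->.
by move=> [/FP Px cx]; have : [set v] x by rewrite ev.
Qed.

Lemma vertex_convex_hull s v : vertex (convex_hull [set` s]) v -> v \in s.
Proof. by move=> /face_meets_generators /(_ erefl) [y ys <-]. Qed.

End Hull.

(** * Connectivity and regularity by computation *)

Section IndexGraph.
Variable nb : nat -> seq nat.
Implicit Types (L T : seq nat).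

(** Depth-first search in the graph induced on [L]; [seen] are the vertices
    already visited.  Fuel running out can only make the result smaller, which
    keeps the check below sound. *)
Fixpoint search L fuel seen todo : seq nat :=
  if fuel is fuel'.+1 then
    if todo is x :: todo' then
      if x \in seen then search L fuel' seen todo'
      else search L fuel' (x :: seen) ([seq y <- nb x | y \in L] ++ todo')
    else seen
  else seen.

Definition connected_on L : bool :=
  if L is r :: _ then
    (* Each of the [size L] vertices puts at most 4 neighbours on the stack in
       the 4-regular graphs considered here. *)
    all (mem (search L (5 * size L)%N [::] [:: r])) L
  else false.

Definition regular_on k L : bool :=
  all (fun i => size [seq j <- nb i | j \in L] == k) L.

(** The case [a = b] covers the deletion of a single vertex. *)
Definition triconnected_on L : bool :=
  [&& (3 < size L)%N, connected_on L &
    all (fun a => all (fun b => connected_on [seq i <- L | (i != a) && (i != b)]) L) L].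

(* [K] is a graph whose vertices are enumerated by [p] along [L]. *)
Variables (V : Type) (p : nat -> V) (K : graph V) (L : seq nat).
Hypothesis vertK : forall x, vert K x <-> exists2 i, i \in L & x = p i.
Hypothesis adjK : forall i j, i \in L -> j \in L -> j \in nb i -> adj K (p i) (p j).

Lemma connected_onP : connected_on L -> connected_graph K.
Proof.
rewrite /connected_on; case eL: L => [//|r L']; rewrite -eL => /allP all_in.
have rL : r \in L by rewrite eL mem_head.
pose reach i := clos_refl_trans V (adj K) (p r) (p i).
have sound fuel seen todo :
    {in seen, forall i, reach i} ->
    {in todo, forall i, i \in L /\ reach i} ->
    {in search L fuel seen todo, forall i, reach i}.
  elim: fuel seen todo => [//|fuel IH] seen [//|x todo] hs ht /=.
  have [xL rx] := ht x (mem_head _ _).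
  case: ifP => _; apply: IH => // y; rewrite ?inE ?mem_cat ?mem_filter.
  - by move=> yt; apply: ht; rewrite inE yt orbT.
  - by move=> /predU1P[->|/hs].
  - move=> /orP[/andP[yL ynb]|yt]; last by apply: ht; rewrite inE yt orbT.
    by split=> //; apply: rt_trans rx _; apply: rt_step; apply: adjK.
have reachL i : i \in L -> reach i.
  move=> iL; apply: (sound (5 * size L)%N [::] [:: r]) (all_in i iL) => // j.
  by rewrite inE => /eqP ->; split=> //; apply: rt_refl.
have rt_sym x y : clos_refl_trans V (adj K) x y -> clos_refl_trans V (adj K) y x.
  elim=> [a b ab|a|a b c _ ba _ cb]; first exact/rt_step/adj_sym.
    exact: rt_refl.
  exact: rt_trans cb ba.
split=> [|u v /vertK [i iL ->] /vertK [j jL ->]].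
  by exists (p r); apply/vertK; exists r.
by apply: rt_trans (rt_sym _ _ (reachL i iL)) (reachL j jL).
Qed.

End IndexGraph.

(** * Induced subgraphs of an enumerated graph *)

Section Restriction.
Variables (V : Type) (G : graph V).

Definition restrict (A : set V) : graph V.
Proof.
refine {| vert := vert G `&` A; adj := fun u v => [/\ adj G u v, A u & A v] |}.
- by move=> u v [uv ? ?]; split=> //; apply: adj_sym uv.
- by move=> u [uu _ _]; apply: adj_irr uu.
- by move=> u v [uv ? _]; split=> //; apply: adj_vert uv.
Defined.

Lemma restrict_induced A : induced_subgraph G (restrict A).
Proof.
split=> [x []//|u v] /=; split=> [[uv Au Av]|[[_ Au] [_ Av] uv]] //.
by split=> //; split=> //; [exact: adj_vert uv | exact: adj_vert (adj_sym uv)].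
Qed.

Variables (N : nat) (p : nat -> V) (nb : nat -> seq nat) (T : seq nat).
Hypothesis vertG : forall x, vert G x <-> exists2 i, (i < N)%N & x = p i.
Hypothesis p_inj : forall i j, (i < N)%N -> (j < N)%N -> p i = p j -> i = j.
Hypothesis adjG : forall i x, (i < N)%N ->
  adj G (p i) x <-> exists2 j, j \in nb i & x = p j.
Hypothesis nbN : forall i j, (i < N)%N -> j \in nb i -> (j < N)%N.
Hypothesis nb_uniq : forall i, (i < N)%N -> uniq (nb i).
Hypothesis TN : forall i, i \in T -> (i < N)%N.
Hypothesis T_uniq : uniq T.

Let H := restrict (p @` [set` T]).

Let vertH x : vert H x <-> exists2 i, i \in T & x = p i.
Proof.
split=> [[_ [i iT <-]]|[i iT ->]]; first by exists i.
by split; [apply/vertG; exists i => //; exact: TN | exists i].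
Qed.

Let vertHp i : (i < N)%N -> vert H (p i) <-> i \in T.
Proof.
move=> iN; split=> [/vertH [j jT /p_inj]|iT]; last by apply/vertH; exists i.
by move=> -> //; exact: TN.
Qed.

Let adjH i j : i \in T -> j \in T -> j \in nb i -> adj H (p i) (p j).
Proof.
move=> iT jT ji; split; [|by exists i|by exists j].
by apply/adjG; [exact: TN|exists j].
Qed.

Let card_image (L : seq nat) : uniq L -> {subset L <= gtn N} ->
  p @` [set` L] #= `I_(size L).
Proof.
move=> uL LN; apply: card_eq_trans (card_set_seq uL); apply: inj_card_eq.
by move=> i j; rewrite !inE => /LN iN /LN jN; apply: p_inj.
Qed.

Lemma restrict_non_separating :
  connected_on nb [seq i <- iota 0 N | i \notin T] -> non_separating G H.
Proof.
apply: (connected_onP (p := p)) => [x|i j].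
  split=> [[/vertG [i iN ->] nHi]|[i]].
    exists i => //; rewrite mem_filter mem_iota /= add0n iN andbT.
    by apply/negP => iT; apply: nHi; apply/vertH; exists i.
  rewrite mem_filter mem_iota => /andP[iT /= iN] ->.
  by split; [apply/vertG; exists i | move/(vertHp iN); apply/negP].
rewrite !mem_filter !mem_iota => /andP[iT /= iN] /andP[jT /= jN] ji.
split; first by apply/adjG => //; exists j.
  by move/(vertHp iN); apply/negP.
by move/(vertHp jN); apply/negP.
Qed.

Lemma restrict_regular k : regular_on nb k T -> regular_graph k H.
Proof.
move=> /allP reg u /vertH [i iT ->]; have iN := TN iT.
rewrite -(eqP (reg i iT)).
have -> : [set v | adj H (p i) v] = p @` [set` [seq j <- nb i | j \in T]].
  apply/seteqP; split=> [v [/(adjG _ iN) [j ji ->] _ [l lT elj]]|v [j]] /=.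
    exists j => //=; rewrite mem_filter ji andbT.
    by rewrite -(p_inj (TN lT) (nbN iN ji) elj).
  by rewrite mem_filter => /andP[jT ji] <-; apply: adjH.
apply: card_image; first by rewrite filter_uniq ?nb_uniq.
by move=> j; rewrite mem_filter => /andP[_ /(nbN iN)].
Qed.

Lemma restrict_3connected : triconnected_on nb T -> k_connected 3 H.
Proof.
move=> /and3P[T4 conT /allP con2].
have eqT : vert H = p @` [set` T].
  by apply/seteqP; split=> x; [move/vertH => [i iT ->]; exists i
    | move=> [i iT <-]; apply/vertH; exists i].
split=> [|S SH S3].
  by rewrite eqT (card_le_eqr (card_image T_uniq TN)) card_le_II.
(* The indices of the deleted vertices. *)
pose D := [seq i <- T | `[< S (p i) >]].
have inD i : (i \in D) = (i \in T) && `[< S (p i) >] by rewrite mem_filter andbC.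
have eqS : S = p @` [set` D].
  apply/seteqP; split=> [x Sx|x [i]] /=; last first.
    by move=> /[swap] <-; rewrite inD => /andP[_ /asboolP].
  have /vertH [i iT ex] := SH x Sx; exists i => //=.
  by rewrite inD iT; apply/asboolP; rewrite -ex.
have D3 : (size D < 3)%N.
  rewrite ltnNge; apply/negP => D3; apply: S3; rewrite eqS.
  rewrite (card_le_eqr (card_image _ _)) ?card_le_II ?filter_uniq //.
  by move=> i; rewrite mem_filter => /andP[_ /TN].
apply: (connected_onP (nb := nb) (p := p) (L := [seq i <- T | i \notin D])).
- move=> x; split=> [[/vertH [i iT ->] nS]|[i]].
    exists i => //; rewrite mem_filter iT andbT inD iT /=.
    by apply/negP => /asboolP.
  rewrite mem_filter inD => /andP[+ iT] ->; rewrite iT /= => /asboolP nS.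
  by split=> //; apply/vertH; exists i.
- move=> i j; rewrite mem_filter inD => /andP[+ iT]; rewrite iT /= => /asboolP nSi.
  rewrite mem_filter inD => /andP[+ jT] ji; rewrite jT /= => /asboolP nSj.
  by split=> //; apply: adjH.
have DT : {subset D <= T} by move=> i; rewrite inD => /andP[].
case: D D3 DT {inD eqS} => [|a [|b []]] // _ DT.
- by rewrite (eq_filter (a2 := predT)) ?filter_predT.
- have /allP /(_ a (DT _ (mem_head _ _))) := con2 a (DT _ (mem_head _ _)).
  by congr connected_on; apply: eq_filter => i; rewrite inE andbb.
- have bD : b \in [:: a; b] by rewrite !inE eqxx orbT.
  have /allP /(_ b (DT _ bD)) := con2 a (DT _ (mem_head _ _)).
  by congr connected_on; apply: eq_filter => i; rewrite !inE negb_or.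
Qed.

End Restriction.

(** * The polytope *)

(** The inequalities [dot a x <= 1], one for each facet. *)
Definition normals : seq (seq int) :=
  ([:: [:: 1; -1; -3; 1]; [:: -1; -2; 1; -1]; [:: -2; 0; -1; 1];
     [:: -2; 1; 1; 0]; [:: -3; 2; 0; 0]; [:: 2; -1; 2; 1];
     [:: 0; 2; -2; -1]; [:: 1; -1; 1; 0]; [:: 0; -1; -1; -1];
     [:: 3; 2; -2; 0]; [:: 0; 0; 0; 2]; [:: -1; -1; -1; 0]])%Z.

(** Homogeneous coordinates: [(d, x)] stands for the point [x / d].  The 26
    vertices of the subgraph come first. *)
Definition points : seq (int * seq int) :=
  ([:: (34, [:: -8; -22; -1; 17]); (7, [:: -2; -4; -1; 2]); (23, [:: 10; -14; -2; -7]);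
     (44, [:: -5; -30; 1; 22]); (9, [:: -2; -4; -3; -2]); (5, [:: -1; 1; -2; 1]);
     (9, [:: -1; 3; -3; 4]); (8, [:: -3; -1; -4; -2]); (42, [:: -4; 14; -13; 21]);
     (4, [:: 2; 3; 5; -7]); (10, [:: -4; -3; 5; 5]); (13, [:: -5; -1; -3; -9]);
     (15, [:: -7; -3; -5; -7]); (2, [:: 1; -1; 0; -1]); (5, [:: 3; 3; 5; -9]);
     (11, [:: 5; 1; 3; -15]); (5, [:: 3; -1; 1; -5]); (17, [:: -7; -2; -8; -5]);
     (20, [:: -2; 7; -6; 10]); (5, [:: 1; 4; 3; 1]); (2, [:: 0; 1; 1; 1]);
     (7, [:: 4; 6; 9; -13]); (9, [:: 5; 8; 11; -15]); (26, [:: 4; 19; 12; 13]);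
     (7, [:: -3; -1; -3; -3]); (5, [:: 3; 4; 6; -9]); (25, [:: -3; 8; -9; 9]);
     (52, [:: 30; -25; -6; -21]); (66, [:: 20; -1; -4; 33]); (38, [:: 6; -5; -15; -18]);
     (6, [:: -2; -1; -3; -2]); (4, [:: -2; -1; 1; 1]); (22, [:: -10; -7; 9; 11]);
     (4, [:: -2; -1; -1; -1]); (11, [:: -1; 4; 5; -13]); (11, [:: 6; 9; 14; -21]);
     (10, [:: -4; -1; 3; 5]); (5, [:: 1; 4; 3; -3]); (5, [:: 3; -2; 0; -3])])%Z.

(** [1 - dot a x] for the [f]-th normal [a] and the [v]-th point [x], multiplied
    by the denominator of [x]. *)
Definition slack (f v : nat) : int :=
  let a := nth [::] normals f in
  let x := nth (1, [::]) points v in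
  x.1 - (a`_0 * x.2`_0 + a`_1 * x.2`_1 + a`_2 * x.2`_2 + a`_3 * x.2`_3).

Definition facets_at_table : seq (seq nat) := Eval vm_compute in
  [seq [seq f <- iota 0 12 | slack f u == 0] | u <- iota 0 39].

Definition facets_at (v : nat) : seq nat := nth [::] facets_at_table v.

(** The [j]-th neighbour of [u] is the vertex off the [j]-th facet at [u] and on
    the others, as required by [corner]. *)
Definition neighbours_table : seq (seq nat) := Eval vm_compute in
  [seq [seq head 0%N [seq t <- iota 0 39 | (t != u) &&
            all (fun g => (g == f) || (slack g t == 0)) (facets_at u)]
       | f <- facets_at u] | u <- iota 0 39].

Definition neighbours (v : nat) : seq nat := nth [::] neighbours_table v.

Definition obstruction : seq nat := iota 0 26.

Definition weight (v : nat) : int := (nth (1, [::]) points v).1.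

(** The hypotheses of [corner] at the vertex [v], in terms of integers. *)
Definition simple_at (v : nat) : bool :=
  let fs := facets_at v in
  let ns := neighbours v in
  [&& size fs == 4%N, size ns == 4%N, uniq ns, all (gtn 12) fs, all (gtn 39) ns,
    all (fun j => slack (nth 0%N fs j) v == 0) (iota 0 4) &
    all (fun j => all (fun k =>
      if k == j then 0 < slack (nth 0%N fs j) (nth 0%N ns k)
      else slack (nth 0%N fs j) (nth 0%N ns k) == 0) (iota 0 4)) (iota 0 4)].

Lemma all_iota m (Q : pred nat) :
  reflect (forall i, (i < m)%N -> Q i) (all Q (iota 0 m)).
Proof.
apply: (iffP allP) => h i; first by move=> im; apply: h; rewrite mem_iota.
by rewrite mem_iota => /h.
Qed.

Lemma weight_gt0 v : (v < 39)%N -> 0 < weight v.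
Proof. by move: v; apply/all_iota; vm_compute. Qed.

Lemma slack_ge0 f v : (f < 12)%N -> (v < 39)%N -> 0 <= slack f v.
Proof.
move=> f12; move: v; apply/all_iota; move: f f12; apply/all_iota.
by vm_compute.
Qed.

Lemma simple_vertices v : (v < 39)%N -> simple_at v.
Proof. by move: v; apply/all_iota; vm_compute. Qed.

Lemma separated_vertices u v : (u < 39)%N -> (v < 39)%N ->
  (u == v) || has (fun f => 0 < slack f v) (facets_at u).
Proof.
move=> u39; move: v; apply/all_iota; move: u u39; apply/all_iota.
by vm_compute.
Qed.

(** In the dual sphere: the set of tetrahedra contains no vertex star. *)
Lemma facet_leaves_obstruction f : (f < 12)%N ->
  has (fun v => (v \notin obstruction) && (slack f v == 0)) (iota 0 39).
Proof. by move: f; apply/all_iota; vm_compute. Qed.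

Lemma obstruction_lt v : v \in obstruction -> (v < 39)%N.
Proof. by rewrite mem_iota => /andP[_ v26]; apply: leq_trans v26 _. Qed.

Section Example.
Variable R : realType.

Definition point (v : nat) : 'rV[R]_4 :=
  \row_i ((((nth (1, [::]) points v).2)`_i)%:~R / (weight v)%:~R).

Definition normal (f : nat) : 'rV[R]_4 := \row_i (((nth [::] normals f)`_i)%:~R).

Definition example : set 'rV[R]_4 :=
  convex_hull [set` [seq point v | v <- iota 0 39]].

Lemma slackE f v : (v < 39)%N ->
  1 - dot (normal f) (point v) = (slack f v)%:~R / (weight v)%:~R.
Proof.
move=> /weight_gt0 w0; have w0' : (weight v)%:~R != 0 :> R by rewrite intr_eq0 gt_eqF.
rewrite /dot !big_ord_recl big_ord0 !mxE /= addr0 /slack.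
rewrite -/(weight v) !(intrB, intrD, intrM) mulrBl divff //.
by rewrite !mulrDl !mulrA -!addrA.
Qed.

Lemma dot_lt1 f v : (v < 39)%N ->
  (dot (normal f) (point v) < 1) = (0 < slack f v).
Proof.
move=> v39; rewrite -subr_gt0 slackE // pmulr_lgt0 ?ltr0z //.
by rewrite invr_gt0 ltr0z weight_gt0.
Qed.

Lemma dot_eq1 f v : (v < 39)%N ->
  (dot (normal f) (point v) == 1) = (slack f v == 0).
Proof.
move=> v39; rewrite eq_sym -subr_eq0 slackE // mulf_eq0 invr_eq0 !intr_eq0.
by rewrite [weight v == 0]gt_eqF ?weight_gt0 ?orbF.
Qed.

Lemma point_in_example v : (v < 39)%N -> example (point v).
Proof.
by move=> v39; apply/subset_convex_hull/map_f; rewrite mem_iota.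
Qed.

Lemma example_normal_le1 f x : (f < 12)%N -> example x -> dot (normal f) x <= 1.
Proof.
move=> f12; apply: convex_hull_le => _ /mapP [v + ->]; rewrite mem_iota => v39.
rewrite -subr_ge0 slackE // mulr_ge0 ?ler0z ?slack_ge0 //.
by rewrite invr_ge0 ler0z ltW ?weight_gt0.
Qed.

Lemma corner_example v : (v < 39)%N ->
  corner example (point v) (fun j : 'I_4 => point (nth 0%N (neighbours v) j))
    (fun j => normal (nth 0%N (facets_at v) j)) (fun=> 1).
Proof.
move=> v39; have /and5P[/eqP sf /eqP sn _ /allP f12 /and3P[/allP n39 tight off]]
  := simple_vertices v39.
have f_lt (j : 'I_4) : (nth 0%N (facets_at v) j < 12)%N.
  by apply: f12; rewrite mem_nth ?sf.
have n_lt (j : 'I_4) : (nth 0%N (neighbours v) j < 39)%N.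
  by apply: n39; rewrite mem_nth ?sn.
have off' (j k : 'I_4) := elimT (all_iota _ _) (elimT (all_iota _ _) off j (ltn_ord j)) k (ltn_ord k).
split.
- exact: point_in_example.
- by move=> j; apply/point_in_example/n_lt.
- by move=> j x; apply/example_normal_le1/f_lt.
- by move=> j; apply/eqP; rewrite dot_eq1 //; exact: (elimT (all_iota _ _) tight).
- move=> j k jk; apply/eqP; rewrite dot_eq1 //.
  by have := off' j k; rewrite eq_sym (inj_eq val_inj) (negPf jk).
- by move=> j; rewrite dot_lt1 //; have := off' j j; rewrite eqxx.
Qed.

Lemma point_inj u v : (u < 39)%N -> (v < 39)%N -> point u = point v -> u = v.
Proof.
move=> u39 v39 euv; have /orP[/eqP //|/hasP [f fu]] := separated_vertices u39 v39.
have /and5P[/eqP sf _ _ _ /and3P[_ /all_iota tight _]] := simple_vertices u39.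
have f4 : (index f (facets_at u) < 4)%N by rewrite -sf index_mem.
have := tight _ f4; rewrite nth_index // -dot_eq1 // -dot_lt1 // -euv => /eqP ->.
by rewrite ltxx.
Qed.

Lemma vertex_example x : vertex example x <-> exists2 v, (v < 39)%N & x = point v.
Proof.
split=> [/vertex_convex_hull/mapP [v]|[v v39 ->]].
  by rewrite mem_iota => v39 ->; exists v.
exact: vertex_corner (corner_example v39).
Qed.

Lemma edge_example v x : (v < 39)%N ->
  edge_between example (point v) x <-> exists2 u, u \in neighbours v & x = point u.
Proof.
move=> v39; have /and5P[_ /eqP sn _ _ /and3P[/allP n39 _ _]] := simple_vertices v39.
have vw (j : 'I_4) : vertex example (point (nth 0%N (neighbours v) j)).
  by apply/vertex_example; eexists; [|reflexivity]; apply/n39/mem_nth; rewrite sn.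
apply: iff_trans (edge_corner (corner_example v39) x vw) _.
split=> [[j ->]|[u un ->]].
  by exists (nth 0%N (neighbours v) j) => //; rewrite mem_nth ?sn.
have un4 : (index u (neighbours v) < 4)%N by rewrite -sn index_mem.
by exists (Ordinal un4); rewrite /= nth_index.
Qed.

Lemma simple_example : simple_polytope 4 example.
Proof.
split; first by eexists.
  exact: has_dim_corner (@corner_example 0%N isT).
by move=> _ /vertex_example [v v39 ->]; apply: card_facets_corner (corner_example v39).
Qed.

Definition obstruction_graph : graph 'rV[R]_4 :=
  restrict (polytope_graph example) (point @` [set` obstruction]).

(** Every facet is that of an inequality [f] from the list, so it has a vertex
    [point u] with [u] outside the obstruction, and this is also a vertex of the
    facet as a polytope in its own right. *)
Lemma obstruction_not_facet : ~ graph_of_facet example obstruction_graph.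
Proof.
move=> [F [facF [eH _]]].
have [fF [k [dF _]]] := facF; have [y Fy] := has_dim_nonempty dF.
have [_ /mapP [v + ->] Fv] := face_meets_generators fF Fy.
rewrite mem_iota => v39; have cv := corner_example v39.
have [j eF] : exists j : 'I_4, F = _ := (facet_corner cv F).1 (conj facF Fv).
have /and5P[/eqP sf _ _ /allP f12 _] := simple_vertices v39.
have /facet_leaves_obstruction/hasP [u] : (nth 0%N (facets_at v) j < 12)%N.
  by apply: f12; rewrite mem_nth ?sf.
rewrite mem_iota => u39 /andP[uT su].
have Fu : F (point u).
  rewrite eF; split; first exact: point_in_example.
  by apply/eqP; rewrite dot_eq1.
have : vert obstruction_graph (point u).
  rewrite eH; apply: (@vertex_subset _ _ example) => [x||]; first by rewrite eF => -[].
    exact: Fu.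
  by apply/vertex_example; exists u.
move=> [_ [i iT /point_inj iu]]; move: uT; rewrite -iu ?iT //.
exact: obstruction_lt.
Qed.

End Example.

Theorem mainTheorem2 (R : realType) :
  exists (n : nat) (P : set 'rV[R]_n),
    [/\ simple_polytope 4 P,
        ~ weakly_satisfies_Perles 4 P
      & exists H : graph 'rV[R]_n,
          [/\ induced_subgraph (polytope_graph P) H,
              k_connected 3 H,
              regular_graph 3 H,
              non_separating (polytope_graph P) H
            & ~ graph_of_facet P H]].
Proof.
exists 4%N, (@example R).
pose G := polytope_graph (@example R).
have vertG x : vert G x <-> exists2 v, (v < 39)%N & x = point R v.
  exact: vertex_example.
have adjG v x : (v < 39)%N -> adj G (point R v) x <->
    exists2 u, u \in neighbours v & x = point R u.
  exact: edge_example.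
have nb39 v u : (v < 39)%N -> u \in neighbours v -> (u < 39)%N.
  by move=> /simple_vertices/and5P[_ _ _ _ /and3P[/allP h _ _]] /h.
have nb_uniq v : (v < 39)%N -> uniq (neighbours v).
  by move=> /simple_vertices/and5P[].
have uT : uniq obstruction by exact: iota_uniq.
have indH : induced_subgraph G (obstruction_graph R) by exact: restrict_induced.
have con3 : k_connected 3 (obstruction_graph R).
  by apply: (restrict_3connected vertG (@point_inj R) adjG obstruction_lt uT); vm_compute.
have reg3 : regular_graph 3 (obstruction_graph R).
  by apply: (restrict_regular vertG (@point_inj R) adjG nb39 nb_uniq obstruction_lt); vm_compute.
have nsep : non_separating G (obstruction_graph R).
  by apply: (restrict_non_separating vertG (@point_inj R) adjG obstruction_lt); vm_compute.
split; first exact: simple_example.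
  by move=> /(_ (obstruction_graph R) indH con3 reg3 nsep); apply: obstruction_not_facet.
exists (obstruction_graph R); split=> //; exact: obstruction_not_facet.
Qed.
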